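(* Let $M^n$ be a closed $n$-dimensional Riemannian manifold. Suppose that $\mathfrak{a}$ is a smooth symmetric $(0,2)$ tensor field on $M^n$, and $\mathcal{A}$ is its dual tensor field of type $(1,1)$. Suppose the following conditions are satisfied: (i) the number $g$ of distinct eigenvalues of $\mathcal{A}$ is a constant and $g<n$; (ii) $\mathrm{tr}(\mathcal{A}^k)$ $(k=1,\dots,g)$ are constants. Then the eigenvalues of $\mathcal{A}$ are all constants.
   Context: A closed manifold is a compact manifold without boundary. The dual $(1,1)$ tensor field $\mathcal{A}$ of $\mathfrak{a}$ is defined by $\langle \mathcal{A}X,Y\rangle=\mathfrak{a}(X,Y)$ for all tangent vectors $X,Y$, where $\langle\cdot,\cdot\rangle$ is the Riemannian metric.
   Formalization: The manifold is additionally assumed connected; without this the claim fails, e.g. on two disjoint flat 3-tori with eigenvalues (2,-1,-1) and (1,1,-2), where g=2, tr A=0 and tr A^2=6. *)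

(* Defs.v *)
From HB Require Import structures.
From mathcomp Require Export all_boot all_order all_algebra.
From mathcomp Require Export all_classical all_reals all_analysis.
Export Order.TTheory GRing.Theory Num.Theory numFieldNormedType.Exports.
Export passmx.

#[export] Set Implicit Arguments.
#[export] Unset Strict Implicit.
#[export] Unset Printing Implicit Defensive.

Local Open Scope classical_set_scope.
Local Open Scope ring_scope.

Section Smooth.
Context {R : realType} {V W : normedModType R}.

(* Meant for an open set U: only the restriction of f to U matters then. *)
Fixpoint C_on (k : nat) (U : set V) (f : V -> W) : Prop :=
  if k is k'.+1 then
    (forall x, U x -> differentiable f x) /\
    (forall v, C_on k' U (fun x => 'D_v f x))
  else forall x, U x -> {for x, continuous f}.

Definition smooth_on (U : set V) (f : V -> W) := forall k, C_on k U f.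

Lemma smooth_on_differentiable (U : set V) (f : V -> W) x :
  smooth_on U f -> U x -> differentiable f x.
Proof. by move=> /(_ 1%N)[+ _]; apply. Qed.

Lemma derive_comp_diff (U : normedModType R) (f : U -> V) (h : V -> W) x y u :
  differentiable f x -> f x = y -> differentiable h y ->
  'D_u (h \o f) x = 'd h y ('d f x u).
Proof.
move=> df <- dh; rewrite deriveE; last exact: differentiable_comp.
by rewrite diff_comp.
Qed.

End Smooth.

(* Charts are modelled on open subsets of R^n, so there is no boundary. Both
   a chart [coord i] and its inverse [param i] are total functions, and are
   meaningful on [dom i] and on [coord i @` dom i] respectively. Smoothness
   with respect to this atlas and to its maximal extension coincide. *)
Record smooth_manifold (R : realType) (n : nat) := SmoothManifold {
  carrier :> topologicalType;
  manifold_hausdorff : hausdorff_space carrier;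
  manifold_second_countable : @second_countable carrier;
  chart : Type;
  dom : chart -> set carrier;
  coord : chart -> carrier -> 'rV[R]_n;
  param : chart -> 'rV[R]_n -> carrier;
  dom_cover : forall p, exists i, dom i p;
  dom_open : forall i, open (dom i);
  codom_open : forall i, open (coord i @` dom i);
  coordK : forall i p, dom i p -> param i (coord i p) = p;
  coord_continuous : forall i p, dom i p -> {for p, continuous (coord i)};
  param_continuous : forall i x,
    (coord i @` dom i) x -> {for x, continuous (param i)};
  transition_smooth : forall i j,
    smooth_on (coord i @` (dom i `&` dom j)) (coord j \o param i)
}.

Arguments chart {R n} _.
Arguments dom {R n s} i _.
Arguments coord {R n s} i _.
Arguments param {R n s} i _.

Section TangentSpace.
Context {R : realType} {n : nat} {M : smooth_manifold R n}.

Definition chart_at (p : M) := {i : chart M | dom i p}.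

Lemma dom_chart_at (p : M) (i : chart_at p) : dom (sval i) p.
Proof. exact: (svalP i). Qed.

Definition transition (i j : chart M) : 'rV[R]_n -> 'rV[R]_n :=
  coord j \o param i.

(* A tangent vector at p is given by its components in all the charts around
   p, transforming under the differentials of the changes of coordinates. *)
Definition contravariant (p : M) : {pred chart_at p -> 'rV[R]_n} :=
  fun v => `[< forall i j : chart_at p,
    v j = 'd (transition (sval i) (sval j)) (coord (sval i) p) (v i) >].

Record tangent (p : M) := Tangent {
  components : chart_at p -> 'rV[R]_n;
  componentsP : components \in @contravariant p
}.

HB.instance Definition _ p := [isSub for @components p].
HB.instance Definition _ p := [Choice of tangent p by <:].

Fact contravariant_submod_closed p : submod_closed (@contravariant p).
Proof.
split; first by apply/asboolP => i j /=; rewrite linear0.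
move=> c u v /asboolP uP /asboolP vP; apply/asboolP => i j /=.
rewrite (_ : (c *: u + v) j = c *: u j + v j)//.
by rewrite (_ : (c *: u + v) i = c *: u i + v i)// linearP/= -uP -vP.
Qed.

HB.instance Definition _ p := GRing.isSubmodClosed.Build R
  (chart_at p -> 'rV[R]_n) (@contravariant p) (@contravariant_submod_closed p).
HB.instance Definition _ p := [SubChoice_isSubLmodule of tangent p by <:].

Lemma image_coord_open (i : chart M) (A : set M) :
  open A -> A `<=` dom i -> open (coord i @` A).
Proof.
move=> oA Ai.
rewrite (_ : _ @` _ = (coord i @` dom i) `&` (param i @^-1` A)).
  rewrite openE => x [Dx Ax]; apply: filterI.
    by apply: open_nbhs_nbhs; split; first exact: codom_open.
  by apply: (param_continuous Dx); apply: open_nbhs_nbhs; split.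
apply/seteqP; split => x /=.
  by move=> [p Ap <-]; split; [exists p => //; exact: Ai|rewrite coordK//; exact: Ai].
by move=> [[p ip <-]]; rewrite coordK// => Ap; exists p.
Qed.

Lemma transition_differentiable (p : M) (i j : chart_at p) :
  differentiable (transition (sval i) (sval j)) (coord (sval i) p).
Proof.
apply: (smooth_on_differentiable (transition_smooth (sval i) (sval j))).
by exists p => //; split; exact: dom_chart_at.
Qed.

Lemma diff_transition_id (p : M) (i : chart_at p) u :
  'd (transition (sval i) (sval i)) (coord (sval i) p) u = u.
Proof.
rewrite -deriveE; last exact: transition_differentiable.
rewrite (@near_eq_derive _ _ _ _ id); first by rewrite derive_id.
near=> x; have [q iq <-] : (coord (sval i) @` dom (sval i)) x.
  near: x; apply: open_nbhs_nbhs; split; first exact: codom_open.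
  by exists p => //; exact: dom_chart_at.
by rewrite /transition /= coordK.
Unshelve. all: by end_near. Qed.

Lemma diff_transition_comp (p : M) (i j k : chart_at p) u :
  'd (transition (sval j) (sval k)) (coord (sval j) p)
    ('d (transition (sval i) (sval j)) (coord (sval i) p) u) =
  'd (transition (sval i) (sval k)) (coord (sval i) p) u.
Proof.
have eqj : transition (sval i) (sval j) (coord (sval i) p) = coord (sval j) p.
  by rewrite /transition /= coordK//; exact: dom_chart_at.
rewrite -[RHS]deriveE; last exact: transition_differentiable.
rewrite (@near_eq_derive _ _ _ _
  (transition (sval j) (sval k) \o transition (sval i) (sval j))).
  by rewrite (derive_comp_diff _ (transition_differentiable i j) eqj
    (transition_differentiable j k)).
near=> x.
have [q [iq jq] <-] : (coord (sval i) @` (dom (sval i) `&` dom (sval j))) x.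
  near: x; apply: open_nbhs_nbhs; split; last first.
    by exists p => //; split; exact: dom_chart_at.
  by apply: image_coord_open => [|? []//]; apply: openI; exact: dom_open.
by rewrite /transition /= (coordK iq) (coordK jq).
Unshelve. all: by end_near. Qed.

Fact tangent_of_subproof (p : M) (i : chart_at p) (u : 'rV[R]_n) :
  (fun j : chart_at p =>
    'd (transition (sval i) (sval j)) (coord (sval i) p) u)
  \in @contravariant p.
Proof. by apply/asboolP => j k; exact/esym/(diff_transition_comp i j k). Qed.

Definition tangent_of (p : M) (i : chart_at p) (u : 'rV[R]_n) : tangent p :=
  Tangent (tangent_of_subproof i u).

Lemma tangent_ofK (p : M) (i : chart_at p) :
  cancel (tangent_of i) (fun v => components v i).
Proof. by move=> u; exact: diff_transition_id. Qed.

Lemma componentsK (p : M) (i : chart_at p) :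
  cancel (fun v => components v i) (@tangent_of p i).
Proof.
move=> v; apply: val_inj; apply: funext => j /=.
by have /asboolP/(_ i j) := componentsP v.
Qed.

Definition some_chart_at (p : M) : chart_at p := cid (dom_cover p).

Fact tangent_vect_iso p : Vector.axiom n (tangent p).
Proof.
exists (fun v => components v (some_chart_at p)) => [c u v|]//.
exact: (Bijective (componentsK _) (@tangent_ofK _ _)).
Qed.

HB.instance Definition _ p :=
  Lmodule_hasFinDim.Build R (tangent p) (tangent_vect_iso p).

Lemma dim_tangent (p : M) : \dim {:tangent p} = n.
Proof. exact: dimvf. Qed.

(* The k-th coordinate vector field of the chart i, set to 0 off [dom i]. *)
Definition coord_field (i : chart M) (k : 'I_n) (p : M) : tangent p :=
  if pselect (dom i p) is left ip
  then tangent_of (exist _ i ip) (delta_mx 0 k) else 0.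

End TangentSpace.

Section Tensors.
Context {R : realType} {n : nat}.

Definition tensor02 (M : smooth_manifold R n) :=
  forall p : M, {biscalar (tangent p)}.

Definition smooth_tensor02 (M : smooth_manifold R n) (a : tensor02 M) :=
  forall (i : chart M) (k l : 'I_n),
    smooth_on (coord i @` dom i)
      (fun x => a (param i x) (coord_field i k (param i x))
                  (coord_field i l (param i x)) : R^o).

Definition symmetric_tensor02 (M : smooth_manifold R n) (a : tensor02 M) :=
  forall p (X Y : tangent p), a p X Y = a p Y X.

Record riemannian_metric (M : smooth_manifold R n) := RiemannianMetric {
  metric :> forall p : M, {biscalar (tangent p)};
  metric_smooth : @smooth_tensor02 M metric;
  metric_symmetric : @symmetric_tensor02 M metric;
  metric_pos : forall p (X : tangent p), X != 0 -> 0 < metric p X X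
}.

Definition tensor11 (M : smooth_manifold R n) :=
  forall p : M, 'End(tangent p).

Definition is_dual_tensor (M : smooth_manifold R n) (met : riemannian_metric M)
    (a : tensor02 M) (A : tensor11 M) :=
  forall p (X Y : tangent p), met p (A p X) Y = a p X Y.

End Tensors.

Section Endomorphisms.
Context {F : fieldType} {vT : vectType F}.

Definition lfun_exp (f : 'End(vT)) (k : nat) : 'End(vT) :=
  iter k (fun h => (f \o h)%VF) \1%VF.

Definition lfun_trace (f : 'End(vT)) : F :=
  \tr (mxof (vbasis {:vT}) (vbasis {:vT}) f).

End Endomorphisms.

(* Main.v *)
Require Import Defs.
From mathcomp Require Import finmap complex ring.

Local Open Scope classical_set_scope.
Local Open Scope ring_scope.

(** At each point [p] the endomorphism [A p] is self-adjoint for the metric, so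
    it has an eigenbasis over the reals: there are [d p : 'I_n -> R] listing the
    eigenvalues with their multiplicities, and the traces of the powers of [A p]
    are the power sums of [d p] ([selfadjoint_spectrum]). As the manifold is
    connected, it suffices that the multiplicity of each real number as an
    eigenvalue be a locally constant function of the point.

    Fix [p] and let [x j] be the [g] distinct eigenvalues there, of multiplicity
    [m j]. The characteristic polynomial depends continuously on the point,
    so that for [q] near [p] there is an eigenvalue [y j] of [A q] close to each
    [x j]. These are [g] distinct eigenvalues, hence all of them. Two
    Vandermonde arguments now conclude ([eq_multiplicities_near]). First, the
    multiplicities [m' j] of the [y j] take finitely many values, and the
    equality of the power sums of order 0 to [g - 1] yields, in the limit
    [y j = x j], a Vandermonde system for [m' j - m j]; so [m' = m] near [p].
    Secondly, the equality of the sums [\sum_j m j * y j ^+ k] and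
    [\sum_j m j * x j ^+ k] for [k] from 1 to [g] is, after factoring
    [y j - x j], a linear system in the unknowns [m j * (y j - x j)], whose
    matrix is close to a Vandermonde matrix with rescaled rows and hence
    invertible; so [y = x] near [p].

    Up to sign, the characteristic polynomial is computed as a quotient of
    determinants of Gram matrices of [a - x met] and of [met] over the
    coordinate fields of a chart, where continuity is that of the components of
    the tensors. *)

(** * The spectral theorem for self-adjoint real matrices *)

Lemma map_Re_mulmx (R : rcfType) m n (v : 'rV[R[i]]_m) (B : 'M[R]_(m, n)) :
  map_mx (@Re R) (v *m map_mx (real_complex R) B) = map_mx (@Re R) v *m B.
Proof.
apply/rowP => j; rewrite !mxE.
rewrite (big_morph (@Re R) (id1 := 0) (op1 := +%R)) //; last by case=> ? ? [].
apply: eq_bigr => k _; rewrite !mxE.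
by case: (v 0 k) => a b /=; rewrite mulr0 subr0.
Qed.

Lemma map_Im_mulmx (R : rcfType) m n (v : 'rV[R[i]]_m) (B : 'M[R]_(m, n)) :
  map_mx (@Im R) (v *m map_mx (real_complex R) B) = map_mx (@Im R) v *m B.
Proof.
apply/rowP => j; rewrite !mxE.
rewrite (big_morph (@Im R) (id1 := 0) (op1 := +%R)) //; last by case=> ? ? [].
apply: eq_bigr => k _; rewrite !mxE.
by case: (v 0 k) => a b /=; rewrite mulr0 add0r.
Qed.

Section SelfAdjointMatrix.
Variables (R : rcfType) (n : nat) (G : 'M[R]_n.+1).
Hypothesis G_sym : G^T = G.
Hypothesis G_pos : forall u : 'rV_n.+1, u != 0 -> 0 < (u *m G *m u^T) 0 0.

Let dot (u v : 'rV[R]_n.+1) := (u *m G *m v^T) 0 0.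

Let dotC u v : dot u v = dot v u.
Proof.
rewrite /dot -[in LHS](trmxK (u *m G *m v^T)) [in LHS]mxE.
by rewrite trmx_mul trmxK trmx_mul G_sym mulmxA.
Qed.

Let dotP a b u v w : dot (a *: u + b *: v) w = a * dot u w + b * dot v w.
Proof.
rewrite /dot !mulmxDl -!scalemxAl.
by move: (u *m G *m w^T) (v *m G *m w^T) => p q; rewrite !mxE.
Qed.

Let dot_eq0 u : dot u u = 0 -> u = 0.
Proof.
move=> u0; apply/eqP/negPn/negP => /G_pos.
by rewrite -/(dot u u) u0 ltxx.
Qed.

Let dot_ge0 u : 0 <= dot u u.
Proof. by have [->|/G_pos/ltW//] := eqVneq u 0; rewrite /dot !mul0mx mxE. Qed.

Let dot_adj (B : 'M[R]_n.+1) u v : B *m G = G *m B^T ->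
  dot (u *m B) v = dot u (v *m B).
Proof. by move=> BG; rewrite /dot -(mulmxA u) BG trmx_mul !mulmxA. Qed.

(** If a row vector [x + i y] is an eigenvector for [z], then comparing
    [dot (x B) y] with [dot x (y B)] leaves [Im z * (dot x x + dot y y) = 0]. *)
Lemma selfadjoint_eigenvalue_real (B : 'M[R]_n.+1) (z : R[i]) :
  B *m G = G *m B^T -> eigenvalue (map_mx (real_complex R) B) z -> Im z = 0.
Proof.
move=> BG /eigenvalueP[v vB v_neq0].
pose x := map_mx (@Re R) v; pose y := map_mx (@Im R) v.
have xB : x *m B = Re z *: x - Im z *: y.
  rewrite -map_Re_mulmx vB; apply/rowP => j; rewrite !mxE.
  by case: z {vB} (v 0 j) => [a b] [].
have yB : y *m B = Re z *: y + Im z *: x.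
  rewrite -map_Im_mulmx vB; apply/rowP => j; rewrite !mxE.
  by case: z {vB xB} (v 0 j) => [a b] [? ?].
have := dot_adj x y BG.
rewrite (dotC x (y *m B)) xB yB -scaleNr !dotP (dotC y x) => /eqP.
rewrite -subr_eq0.
rewrite (_ : _ - _ = - Im z * (dot x x + dot y y)); last by ring.
rewrite mulf_eq0 oppr_eq0 => /orP[/eqP //|].
rewrite paddr_eq0 ?dot_ge0// => /andP[/eqP/dot_eq0 x0 /eqP/dot_eq0 y0].
case/eqP: v_neq0.
apply/rowP => j; have /rowP/(_ j) := x0; have /rowP/(_ j) := y0.
by rewrite !mxE; case: (v 0 j) => a b /= -> ->.
Qed.

Lemma selfadjoint_horner (B : 'M[R]_n.+1) (p : {poly R}) :
  B *m G = G *m B^T ->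
  horner_mx B p *m G = G *m (horner_mx B p)^T.
Proof.
move=> BG; elim/poly_ind: p => [|p c IH].
  by rewrite rmorph0 mul0mx trmx0 mulmx0.
rewrite rmorphD rmorphM /= horner_mx_X horner_mx_C mulmxDl linearD /= mulmxDr.
rewrite tr_scalar_mx scalar_mxC; congr (_ + _).
have cBp : B *m horner_mx B p = horner_mx B p *m B.
  exact/comm_mx_horner/comm_mx_refl.
by rewrite -!mulmxE -[in RHS]cBp -mulmxA BG mulmxA IH trmx_mul mulmxA.
Qed.

(** Self-adjointness of [P] gives [dot (u P) (u P) = dot u (u P P)], so that
    [P ^+ 2 = 0] forces [P = 0]; nilpotency of a higher order is reduced step
    by step to this case. *)
Lemma selfadjoint_nilpotent_eq0 (N : 'M[R]_n.+1) k :
  N *m G = G *m N^T -> N ^+ k = 0 -> N = 0.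
Proof.
move=> NG; case: k => [|k].
  by rewrite expr0 => /eqP; rewrite oner_eq0.
elim: k => [|k IHk] Nk; first by rewrite -Nk expr1.
(* For P = N ^+ k.+1, the square of P is a multiple of N ^+ k.+2 = 0. *)
apply: IHk; set P := N ^+ k.+1.
have PG : P *m G = G *m P^T.
  by rewrite /P -(horner_mx_X N) -rmorphXn /=; exact: selfadjoint_horner.
have PP : P *m P = 0.
  by rewrite mulmxE /P -exprD addSn -addnS exprD Nk mulr0.
apply/row_matrixP => i; rewrite row0 rowE; apply: dot_eq0.
by rewrite dot_adj// -mulmxA PP mulmx0 /dot trmx0 mulmx0 mxE.
Qed.

(** The minimal polynomial splits over [R], because its complex roots are
    eigenvalues, hence real. The product of its distinct linear factors,
    evaluated at [B], is self-adjoint and nilpotent, hence zero: the minimal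
    polynomial has simple roots. *)
Lemma selfadjoint_diagonalizable (B : 'M[R]_n.+1) :
  B *m G = G *m B^T -> diagonalizable B.
Proof.
move=> BG.
have [rs q_rs] : exists rs : seq R, mxminpoly B = \prod_(r <- rs) ('X - r%:P).
  have [zs] := closed_field_poly_normal (mxminpoly (map_mx (real_complex R) B)).
  rewrite (monicP (mxminpoly_monic _)) scale1r => qE.
  exists (map (@Re R) zs).
  apply: (map_poly_inj (real_complex R)).
  rewrite -mxminpoly_map qE big_map rmorph_prod /=.
  apply: eq_big_seq => z zs_z; rewrite rmorphB /= map_polyX map_polyC /=.
  congr (_ - _%:P); apply/eqP; rewrite eq_complex /= eqxx /=; apply/eqP.
  apply: (selfadjoint_eigenvalue_real BG).
  by rewrite eigenvalue_root_min qE root_prod_XsubC.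
apply/diagonalizableP; exists (undup rs); first exact: undup_uniq.
rewrite dvd_mxminpoly; apply/eqP.
apply: (@selfadjoint_nilpotent_eq0 _ (size rs)).
  exact: selfadjoint_horner.
rewrite -rmorphXn /=; apply/eqP; rewrite -dvd_mxminpoly q_rs.
(* A product of linear factors divides the power of its squarefree part. *)
have : {subset rs <= undup rs} by move=> r; rewrite mem_undup.
elim: {q_rs}rs (undup rs) => [|r s IHs] t s_t.
  by rewrite big_nil expr0 dvd1p.
rewrite big_cons exprS dvdp_mul//.
  by rewrite dvdp_XsubCl root_prod_XsubC s_t// mem_head.
by apply: IHs => r' sr'; rewrite s_t// in_cons sr' orbT.
Qed.
End SelfAdjointMatrix.

Lemma selfadjoint_mx_diagonalizable (R : rcfType) (n : nat) (G B : 'M[R]_n) :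
  G^T = G -> (forall u : 'rV_n, u != 0 -> 0 < (u *m G *m u^T) 0 0) ->
  B *m G = G *m B^T -> diagonalizable B.
Proof.
case: n => [|n] in G B * => G_sym G_pos BG.
  by rewrite thinmx0; exact: diagonalizable0.
exact: selfadjoint_diagonalizable BG.
Qed.

(** * Spectrum of a self-adjoint endomorphism *)

Definition gram_mx (R : nzRingType) (V : lmodType R) m
    (b : V -> V -> R) (X : 'I_m -> V) : 'M[R]_m :=
  \matrix_(i, j) b (X i) (X j).

Section Eigenbasis.
Variables (F : fieldType) (vT : vectType F).
Local Notation n := (\dim {:vT}).
Variables (e : n.-tuple vT) (f : 'End(vT)) (d : 'I_n -> F).
Hypothesis e_basis : basis_of {:vT} e.
Hypothesis f_e : forall i : 'I_n, f e`_i = d i *: e`_i.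

Lemma dim_leigenspace_eigenbasis (l : F) :
  \dim (leigenspace f l) = #|[pred i | d i == l]|.
Proof.
pose s := [seq e`_(i : 'I_n) | i <- enum 'I_n & d i == l].
have s_free : free s.
  have : free [seq e`_(i : 'I_n) | i <- enum 'I_n].
    rewrite (_ : map _ _ = e) ?(basis_free e_basis)//.
    apply: (@eq_from_nth _ 0).
      by rewrite size_map size_enum_ord size_tuple.
    move=> i; rewrite size_map size_enum_ord => i_lt.
    by rewrite (nth_map (Ordinal i_lt)) ?size_enum_ord// nth_enum_ord.
  have /permPl/(perm_map (fun i : 'I_n => e`_i)) :=
    perm_filterC (fun i => d i == l) (enum 'I_n).
  by move=> /perm_free <-; rewrite map_cat => /catl_free.
suff -> : leigenspace f l = span s.
  rewrite (eqP s_free) size_map size_filter cardE /enum_mem size_filter.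
  rewrite count_filter -enumT.
  by apply: eq_count => i /=; rewrite andbT.
apply/eqP; rewrite eqEsubv; apply/andP; split; last first.
  apply/span_subvP => u /mapP[i + ->]; rewrite mem_filter => /andP[/eqP di _].
  rewrite memv_ker; do !rewrite lfunE /=.
  by rewrite f_e di subrr.
apply/subvP => v; rewrite memv_ker; do !rewrite lfunE /=.
rewrite [v](coord_basis e_basis) ?memvf// linear_sum scaler_sumr -sumrB /=.
under eq_bigr do rewrite linearZ /= f_e !scalerA mulrC -scalerBl -mulrBl.
move=> /eqP; move/freeP: (basis_free e_basis) => /[apply] c0.
apply: memv_suml => i _; have [dil|dil] := eqVneq (d i) l.
  apply/memvZ/memv_span/mapP; exists i => //.
  by rewrite mem_filter dil eqxx mem_enum.
have /eqP := c0 i; rewrite mulf_eq0 subr_eq0 (negPf dil) /= => /eqP ->.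
by rewrite scale0r mem0v.
Qed.

Lemma mxof_eigenbasis : mxof e e f = diag_mx (\row_i d i).
Proof.
apply/row_matrixP => i; rewrite rowE mul_mxof vecof_delta f_e linearZ/=.
by rewrite rVofE// row_diag_mx mxE.
Qed.

Lemma lfun_trace_basis (h : 'End(vT)) : lfun_trace h = \tr (mxof e e h).
Proof.
have v_basis := vbasisP {:vT}.
have hE : h = (\1 \o (h \o \1))%VF by rewrite comp_lfun1l comp_lfun1r.
rewrite [in RHS]hE (mxof_comp _ _ v_basis) (mxof_comp _ _ v_basis).
rewrite mxtrace_mulC mulmxA -(mxof_comp _ _ e_basis) comp_lfun1l.
by rewrite mxof1 ?(basis_free v_basis)// mul1mx.
Qed.

Lemma lfun_trace_exp_eigenbasis k : lfun_trace (lfun_exp f k) = \sum_i d i ^+ k.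
Proof.
rewrite lfun_trace_basis.
have -> : mxof e e (lfun_exp f k) = diag_mx (\row_i d i ^+ k).
  elim: k => [|k IHk].
    rewrite /= mxof1 ?(basis_free e_basis)// -diag_const_mx; congr diag_mx.
    by apply/rowP => i; rewrite !mxE expr0.
  rewrite /lfun_exp iterS -/(lfun_exp f k) (mxof_comp _ _ e_basis) IHk.
  rewrite mxof_eigenbasis mulmx_diag.
  by congr diag_mx; apply/rowP => i; rewrite !mxE exprSr.
by rewrite mxtrace_diag; apply: eq_bigr => i _; rewrite mxE.
Qed.

(** Up to sign, the characteristic polynomial of [f] is thus a quotient of
    determinants of Gram matrices, over any family [X] of nonzero Gram
    determinant. This matters because an eigenbasis need not vary
    continuously with the point of a manifold, whereas coordinate vector fields
    do. *)
Lemma det_gram_mx_eigenbasis (b : {biscalar vT}) (X : 'I_n -> vT) (x : F) :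
  \det (gram_mx (fun u v => b (f u) v - x * b u v) X) =
    (\prod_i (d i - x)) * \det (gram_mx b X).
Proof.
have [P XE] : exists P : 'M[F]_n, forall i : 'I_n, X i = \sum_j P i j *: e`_j.
  exists (\matrix_(i, j) vector.coord e j (X i)) => i.
  rewrite [LHS](coord_basis e_basis) ?memvf//.
  by apply: eq_bigr => j _; rewrite mxE.
pose Q : 'M[F]_n := \matrix_(i, j) b e`_i (X j).
transitivity (\det (P *m diag_mx (\row_i (d i - x)) *m Q)).
  congr (\det _); apply/matrixP => i j.
  rewrite !mxE !(XE i) linear_sum /= !linear_sumlz.
  rewrite mulr_sumr -sumrB; apply: eq_bigr => k _.
  rewrite mul_mx_diag linearZ/= f_e !linearZl_LR !mxE; ring.
have -> : gram_mx b X = P *m Q.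
  apply/matrixP => i j; rewrite !mxE (XE i) linear_sumlz.
  by apply: eq_bigr => k _; rewrite linearZl_LR mxE.
rewrite !det_mulmx det_diag.
rewrite (eq_bigr (fun i => d i - x)); last by move=> i _; rewrite mxE.
by ring.
Qed.
End Eigenbasis.

Lemma delta_mulmx_delta (R : pzSemiRingType) n (M : 'M[R]_n) i j :
  ((delta_mx 0 i : 'rV_n) *m M *m (delta_mx 0 j : 'rV_n)^T) 0 0 = M i j.
Proof. by rewrite trmx_delta -rowE -colE !mxE. Qed.

Lemma selfadjoint_eigenbasis (R : rcfType) (vT : vectType R) (b : {biscalar vT})
    (f : 'End(vT)) :
  (forall u v, b u v = b v u) -> (forall u, u != 0 -> 0 < b u u) ->
  (forall u v, b (f u) v = b u (f v)) ->
  exists (e : (\dim {:vT}).-tuple vT) (d : 'I_(\dim {:vT}) -> R),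
    basis_of {:vT} e /\ forall i : 'I_(\dim {:vT}), f e`_i = d i *: e`_i.
Proof.
move=> b_sym b_pos b_adj.
pose e := vbasis {:vT}; have e_basis : basis_of {:vT} e := vbasisP _.
pose B := mxof e e f; pose G := gram_mx b (fun i : 'I_(\dim {:vT}) => e`_i).
have bE u v : b (vecof e u) (vecof e v) = (u *m G *m v^T) 0 0.
  rewrite /vecof linear_sumr mxE; apply: eq_bigr => j _.
  rewrite linearZr_LR linear_sumlz !mxE mulrC; congr (_ * _).
  by apply: eq_bigr => i _; rewrite linearZl_LR !mxE.
have G_sym : G^T = G by apply/matrixP => i j; rewrite !mxE b_sym.
have BG : B *m G = G *m B^T.
  apply/matrixP => i j; rewrite -[LHS]delta_mulmx_delta -[RHS]delta_mulmx_delta.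
  have := b_adj (vecof e (delta_mx 0 i)) (vecof e (delta_mx 0 j)).
  by rewrite !(hom_vecof _ e_basis) -/B !bE trmx_mul !mulmxA.
have [|P P_unit] := selfadjoint_mx_diagonalizable G_sym _ BG.
  by move=> u u_neq0; rewrite -bE b_pos// vecof_eq0.
case/diagonalizable_forPex => d /(simmxP P_unit) PB.
have [e' e'E] : exists e' : (\dim {:vT}).-tuple vT,
    forall i : 'I_(\dim {:vT}), e'`_i = vecof e (row i P).
  exists [tuple vecof e (row i P) | i < \dim {:vT}] => i.
  by rewrite -tnth_nth tnth_mktuple.
exists e', (d 0); split; last first.
  move=> i; rewrite e'E (hom_vecof _ e_basis) -row_mul PB row_mul.
  by rewrite row_diag_mx -scalemxAl -rowE linearZ.
rewrite basisEfree subvf size_tuple leqnn andbT /= andbT.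
apply/freeP => c c0 i; pose u : 'rV_(\dim {:vT}) := \row_i c i.
have uP : u *m P = 0.
  apply: (can_inj (vecofK e_basis)).
  rewrite linear0 mulmx_sum_row linear_sum /=.
  rewrite -[RHS]c0; apply: eq_bigr => j _.
  by rewrite linearZ /= mxE e'E.
have /rowP/(_ i) : u = 0 by rewrite -(mulmxK P_unit u) uP mul0mx.
by rewrite !mxE.
Qed.

Lemma selfadjoint_spectrum (R : rcfType) (vT : vectType R) (n : nat)
    (b : {biscalar vT}) (f : 'End(vT)) :
  \dim {:vT} = n ->
  (forall u v, b u v = b v u) -> (forall u, u != 0 -> 0 < b u u) ->
  (forall u v, b (f u) v = b u (f v)) ->
  exists d : 'I_n -> R, [/\
    forall l, \dim (leigenspace f l) = #|[pred i | d i == l]|,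
    forall k, lfun_trace (lfun_exp f k) = \sum_i d i ^+ k &
    forall (X : 'I_n -> vT) x,
      \det (gram_mx (fun u v => b (f u) v - x * b u v) X) =
        (\prod_i (d i - x)) * \det (gram_mx b X)].
Proof.
move=> <- b_sym b_pos b_adj.
have [e [d [e_basis f_e]]] := selfadjoint_eigenbasis b_sym b_pos b_adj.
exists d; split=> [l|k|X x].
- exact: (dim_leigenspace_eigenbasis e_basis f_e).
- exact: (lfun_trace_exp_eigenbasis e_basis f_e).
- exact: (det_gram_mx_eigenbasis e_basis f_e).
Qed.

(** * Power sums determine nearby values *)

Lemma cvg_exprn (R : numFieldType) (T : Type) (F : set_system T) (FF : Filter F)
    (f : T -> R) (x : R) k :
  f t @[t --> F] --> x -> f t ^+ k @[t --> F] --> x ^+ k.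
Proof.
move=> f_x; elim: k => [|k IHk].
  by rewrite expr0; under eq_cvg do rewrite expr0; exact: cvg_cst.
by rewrite exprS; under eq_cvg do rewrite exprS; exact: cvgM.
Qed.

Lemma cvg_det (R : numFieldType) (T : Type) (F : set_system T) (FF : Filter F) n
    (A : T -> 'M[R]_n) (B : 'M[R]_n) :
  (forall i j, A t i j @[t --> F] --> B i j) ->
  \det (A t) @[t --> F] --> \det B.
Proof.
move=> A_B; apply: cvg_big => [|s _]; first exact: add_continuous.
apply: cvgM; first exact: cvg_cst.
by apply: cvg_big => // ; exact: mul_continuous.
Qed.

Lemma sum_fibers (V : nmodType) (I J : finType) (s : I -> J) (phi : J -> V) :
  \sum_i phi (s i) = \sum_j phi j *+ #|[pred i | s i == j]|.
Proof.
rewrite (partition_big s xpredT) //=; apply: eq_bigr => j _.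
by rewrite -sumr_const; apply: eq_big => // i /eqP ->.
Qed.

Section PowerSums.
Variables (R : numFieldType) (g : nat).
Implicit Types (x y c : 'I_g -> R).

Lemma det_Vandermonde_neq0 x :
  injective x -> \det (Vandermonde g (\row_j x j)) != 0.
Proof.
move=> x_inj; rewrite det_Vandermonde prodf_seq_neq0; apply/allP => i _ /=.
rewrite prodf_seq_neq0; apply/allP => j _; apply/implyP => ij.
by rewrite !mxE subr_eq0 (inj_eq x_inj) -val_eqE /= gtn_eqF.
Qed.

Lemma unitmx_sum_eq0 (A : 'M[R]_g) c : \det A != 0 ->
  (forall k, \sum_j c j * A k j = 0) -> forall j, c j = 0.
Proof.
move=> A_neq0 c0 j; have A_unit : A \in unitmx by rewrite unitmxE unitfE.
have Ac : A *m (\col_j c j) = 0.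
  apply/colP => k; rewrite !mxE -[RHS](c0 k).
  by apply: eq_bigr => i _; rewrite mxE mulrC.
have /colP/(_ j) : \col_j c j = 0.
  by rewrite -(mulKmx A_unit (\col_j c j)) Ac mulmx0.
by rewrite !mxE.
Qed.

Lemma eq_fibers_of_power_sums (I : finType) x (s s' : I -> 'I_g) :
  injective x ->
  (forall k, (k < g)%N -> \sum_i x (s i) ^+ k = \sum_i x (s' i) ^+ k) ->
  forall j, #|[pred i | s i == j]| = #|[pred i | s' i == j]|.
Proof.
move=> x_inj ss' j.
pose c j : R := #|[pred i | s i == j]|%:R - #|[pred i | s' i == j]|%:R.
suff : c j = 0 by move/eqP; rewrite subr_eq0 eqr_nat => /eqP.
apply: (unitmx_sum_eq0 (det_Vandermonde_neq0 x_inj)) => k.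
have := ss' k (ltn_ord k); rewrite !(sum_fibers _ (fun j => x j ^+ k)).
move/eqP; rewrite -subr_eq0 -sumrB => /eqP E; rewrite -[RHS]E.
by apply: eq_bigr => i _; rewrite !mxE mulrBl !mulr_natl.
Qed.

(** The coefficients of the linear system satisfied by the [y j - x j], once
    [y j ^+ k.+1 - x j ^+ k.+1] is factored by [y j - x j]. *)
Definition diff_quotient_mx x y : 'M[R]_g :=
  \matrix_(k, j) \sum_(i < k.+1) y j ^+ (k - i) * x j ^+ i.

(** On the diagonal this is the Jacobian of the power sums, a Vandermonde matrix
    with row [k] scaled by [k.+1]. *)
Lemma det_diff_quotient_mx_diag x :
  injective x -> \det (diff_quotient_mx x x) != 0.
Proof.
move=> x_inj.
have -> : diff_quotient_mx x x =
    diag_mx (\row_k (k : nat).+1%:R) *m Vandermonde g (\row_j x j).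
  apply/matrixP => k j; rewrite mul_diag_mx !mxE.
  rewrite (eq_bigr (fun _ => x j ^+ k)) => [|i _]; last first.
    by rewrite -exprD subnK // -ltnS.
  by rewrite sumr_const card_ord mulr_natl.
rewrite det_mulmx mulf_neq0 ?det_Vandermonde_neq0// det_diag.
by rewrite prodf_seq_neq0; apply/allP => i _; rewrite mxE pnatr_eq0.
Qed.

(** Local injectivity of the weighted power sums, in a form which replaces the
    inverse function theorem by the invertibility of a matrix of difference
    quotients. *)
Lemma eq_of_weighted_power_sums x y c :
  \det (diff_quotient_mx x y) != 0 -> (forall j, c j != 0) ->
  (forall k, (1 <= k <= g)%N -> \sum_j c j * (y j ^+ k - x j ^+ k) = 0) ->
  y =1 x.
Proof.
move=> H_neq0 c_neq0 sum0 j; apply/eqP; rewrite -subr_eq0.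
suff /eqP : c j * (y j - x j) = 0 by rewrite mulf_eq0 (negPf (c_neq0 j)).
apply: (unitmx_sum_eq0 (c := fun j => c j * (y j - x j)) H_neq0) => k.
rewrite -[RHS](sum0 k.+1) ?ltn_ord//; apply: eq_bigr => i _.
by rewrite mxE subrXX mulrA.
Qed.

End PowerSums.

Section Limit.
Variables (R : realType) (T : Type) (F : set_system T).
Context {FF : Filter F}.

(** The root closest to [x] of a split monic polynomial of degree [n] is at a
    distance at most the [n]-th root of the absolute value of the polynomial at
    [x]. *)
Lemma nearest_root_cvg n (d : T -> 'I_n -> R) (x : R) (i0 : 'I_n) :
  \prod_i (d t i - x) @[t --> F] --> 0 ->
  exists2 y : T -> R, y t @[t --> F] --> x & forall t, exists i, y t = d t i.
Proof.
move=> prod0.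
pose m t := [arg min_(i < i0) `|x - d t i| ]%O.
exists (fun t => d t (m t)); last by move=> t; exists (m t).
apply/cvgrPdist_lt => e e_gt0.
have n_gt0 : (0 < n)%N by apply: leq_ltn_trans (ltn_ord i0).
have /cvgrPdist_lt/(_ (e ^+ n)) := prod0.
rewrite exprn_gt0// => /(_ isT); apply: filterS => t.
rewrite sub0r normrN normr_prod => prod_lt.
rewrite -(ltr_pXn2r n_gt0) ?nnegrE ?(ltW e_gt0)//.
apply: le_lt_trans prod_lt.
rewrite -[X in _ ^+ X]card_ord -prodr_const; apply: ler_prod => i _.
rewrite normr_ge0 /= (distrC (d t i)) /m.
by case: arg_minP => // k _; apply.
Qed.

(** Each of the [g] values [x j] of [d0] attracts some value [y j t] of [d t].
    Near [F] these [y j t] are distinct, hence exhaust the [g] values of [d t],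
    so that [d t i = y (s i) t] for a labelling [s] depending on [t]. There are
    only finitely many labellings, so the power sums of order less than [g],
    passed to the limit for each of them, show that near [F] the labelling has
    the multiplicities of [d0]. With the multiplicities known, the power sums of
    order 1 to [g] give [y j t = x j]. *)
Lemma eq_multiplicities_near n g (d : T -> 'I_n -> R) (d0 : 'I_n -> R) :
  size (undup (codom d0)) = g ->
  (forall t, size (undup (codom (d t))) = g) ->
  (forall t k, (1 <= k <= g)%N -> \sum_i d t i ^+ k = \sum_i d0 i ^+ k) ->
  (forall i, \prod_j (d t j - d0 i) @[t --> F] --> 0) ->
  \forall t \near F, forall l,
    #|[pred i | d t i == l]| = #|[pred i | d0 i == l]|.
Proof.
move=> d0_g d_g d_sum d_prod.
pose x (j : 'I_g) := nth 0 (undup (codom d0)) j.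
have x_inj : injective x.
  by move=> i j /eqP; rewrite nth_uniq ?undup_uniq ?d0_g// => /eqP/val_inj.
have /choice[s0 s0E] : forall i, exists j, d0 i = x j.
  move=> i.
  have d0i : d0 i \in undup (codom d0) by rewrite mem_undup codom_f.
  have ig : (index (d0 i) (undup (codom d0)) < g)%N by rewrite -d0_g index_mem.
  by exists (Ordinal ig); rewrite /x /= nth_index.
have x_d0 j : exists i, x j = d0 i.
  have : x j \in undup (codom d0) by rewrite mem_nth ?d0_g.
  by rewrite mem_undup => /codomP.
have [y [y_cvg y_d]] : exists y : 'I_g -> T -> R,
    (forall j, y j t @[t --> F] --> x j) /\ forall j t, exists i, y j t = d t i.
  have /choice[y yP] : forall j : 'I_g, exists y : T -> R,
      (y t @[t --> F] --> x j) /\ forall t, exists i, y t = d t i.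
    move=> j; have [i xj] := x_d0 j.
    have [|y] := @nearest_root_cvg _ d (x j) i.
      by rewrite xj; exact: d_prod.
    by exists y.
  by exists y; split=> j; have [] := yP j.
have near_inj : \forall t \near F, injective (y^~ t).
  suff : \forall t \near F, forall p : 'I_g * 'I_g,
      p.1 != p.2 -> y p.1 t != y p.2 t.
    apply: filterS => t yt i j /eqP; apply: contraTeq => ij.
    exact: (yt (i, j)).
  apply: filter_forall => -[i j] /=; have [->|ij] := eqVneq i j.
    by apply: nearW => t /=; rewrite eqxx.
  have : y i t - y j t @[t --> F] --> x i - x j by apply: cvgB.
  move/cvgr_neq0; rewrite subr_eq0 (inj_eq x_inj) => /(_ ij).
  by apply: filterS => t; rewrite subr_eq0.
have near_det : \forall t \near F, \det (diff_quotient_mx x (y^~ t)) != 0.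
  apply: cvgr_neq0 (det_diff_quotient_mx_diag x_inj).
  apply: cvg_det => k j; rewrite mxE; under eq_cvg do rewrite mxE.
  apply: cvg_big => [|i _]; first exact: add_continuous.
  apply: cvgM; last exact: cvg_cst.
  exact: cvg_exprn.
(* A labelling whose limit has the wrong power sums is excluded near F. *)
have near_sum : \forall t \near F, forall (p : 'I_g * {ffun 'I_n -> 'I_g}),
    \sum_i y (p.2 i) t ^+ p.1 = \sum_i d0 i ^+ p.1 ->
    \sum_i x (p.2 i) ^+ p.1 = \sum_i d0 i ^+ p.1.
  apply: filter_forall => -[k s] /=.
  have [->|neq] := eqVneq (\sum_i x (s i) ^+ k) (\sum_i d0 i ^+ k).
    exact: nearW.
  have : \sum_i y (s i) t ^+ k - \sum_i d0 i ^+ k @[t --> F] -->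
         \sum_i x (s i) ^+ k - \sum_i d0 i ^+ k.
    apply: cvgB; last exact: cvg_cst.
    apply: cvg_big => [|i _]; first exact: add_continuous.
    exact: cvg_exprn.
  move/cvgr_neq0; rewrite subr_eq0 => /(_ neq); apply: filterS => t.
  by rewrite subr_eq0 => /eqP.
near=> t.
have yt_inj : injective (y^~ t) by near: t.
have [s dE] : exists s : {ffun 'I_n -> 'I_g}, forall i, d t i = y (s i) t.
  have [|||size_y mem_y] :=
      @uniq_min_size _ (codom (y^~ t)) (undup (codom (d t))).
  - by rewrite map_inj_uniq ?enum_uniq.
  - move=> _ /codomP[j ->]; rewrite mem_undup; have [i ->] := y_d j t.
    exact: codom_f.
  - by rewrite d_g size_codom card_ord.
  have /choice[s sE] : forall i, exists j, d t i = y j t.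
    by move=> i; apply/codomP; rewrite mem_y mem_undup codom_f.
  by exists (finfun s) => i; rewrite ffunE.
have sum_s k : (k <= g)%N -> \sum_i y (s i) t ^+ k = \sum_i d0 i ^+ k.
  (* The power sum of order 0 is n on both sides. *)
  case: k => [|k] kg; first by apply: eq_bigr => i _; rewrite !expr0.
  by rewrite -(d_sum t)//; apply: eq_bigr => i _; rewrite dE.
have ss0 : forall j, #|[pred i | s i == j]| = #|[pred i | s0 i == j]|.
  apply: (eq_fibers_of_power_sums x_inj) => k kg.
  have -> : \sum_i x (s0 i) ^+ k = \sum_i d0 i ^+ k.
    by apply: eq_bigr => i _; rewrite s0E.
  have : forall p : 'I_g * {ffun 'I_n -> 'I_g},
    \sum_i y (p.2 i) t ^+ p.1 = \sum_i d0 i ^+ p.1 ->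
    \sum_i x (p.2 i) ^+ p.1 = \sum_i d0 i ^+ p.1 by near: t.
  by move=> /(_ (Ordinal kg, s)); apply; exact/sum_s/ltnW.
have yx : y^~ t =1 x.
  apply: (@eq_of_weighted_power_sums _ _ _ _
    (fun j => #|[pred i | s i == j]|%:R)).
  - by near: t.
  - move=> j; have [i xj] := x_d0 j; rewrite ss0 pnatr_eq0 -lt0n.
    apply/card_gt0P; exists i; rewrite inE; apply/eqP/x_inj.
    by rewrite -s0E.
  - move=> k /andP[_ kg]; under eq_bigr do rewrite mulrBr !mulr_natl.
    rewrite sumrB -(sum_fibers s (fun j => y j t ^+ k)).
    under [X in _ - X]eq_bigr do rewrite ss0.
    rewrite -(sum_fibers s0 (fun j => x j ^+ k)) sum_s//.
    by under [X in _ - X]eq_bigr do rewrite -s0E; rewrite subrr.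
have cardE (r : 'I_n -> 'I_g) l : #|[pred i | x (r i) == l]| =
    \sum_j (if x j == l then 1%N else 0%N) *+ #|[pred i | r i == j]|.
  rewrite -sum1_card big_mkcond.
  by rewrite -(sum_fibers r (fun j => if x j == l then 1%N else 0%N)).
move=> l; transitivity #|[pred i | x (s i) == l]|.
  by apply: eq_card => i; rewrite !inE dE yx.
rewrite cardE; under eq_bigr do rewrite ss0.
by rewrite -cardE; apply: eq_card => i; rewrite !inE s0E.
Unshelve. all: by end_near. Qed.

End Limit.

(** * Tensor fields on a connected manifold *)

Lemma locally_constant_connected (T : topologicalType) (Y : Type) (f : T -> Y) :
  connected [set: T] -> (forall p, \forall q \near p, f q = f p) ->
  forall p q, f p = f q.
Proof.
move=> T_conn f_loc p q.
have f_open (P : set Y) : open (f @^-1` P).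
  rewrite openE => r Pr; apply: filterS (f_loc r) => s.
  by rewrite /preimage /= => ->.
have pre_p : f @^-1` [set f p] = [set: T].
  apply: T_conn; first by exists p.
    by exists (f @^-1` [set f p]); rewrite ?setTI.
  exists (f @^-1` [set f p]); rewrite ?setTI//.
  by rewrite -[X in closed X]setCK preimage_setC; exact: open_closedC.
by have : [set: T] q by []; rewrite -pre_p => ->.
Qed.

Lemma card_values_codom (T : choiceType) (I : finType) (f : I -> T) (g : nat) :
  ([set y | exists i, f i = y] #= `I_g)%card -> size (undup (codom f)) = g.
Proof.
move=> f_g; rewrite -(size_seq_fset tt); apply/card_eq_fsetP.
suff -> : [set` seq_fset tt (codom f)] = [set y | exists i, f i = y] by [].
apply/seteqP; split=> y; rewrite /mkset seq_fsetE.
  by move=> /codomP[i ->]; exists i.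
by move=> [i <-]; exact: codom_f.
Qed.

Section CoordinateFields.
Variables (R : realType) (n : nat) (M : smooth_manifold R n).

Lemma smooth_tensor02_cvg (a : tensor02 M) (i : chart M) (k l : 'I_n) (p : M) :
  smooth_tensor02 a -> dom i p ->
  a q (coord_field i k q) (coord_field i l q) @[q --> p] -->
    (a p (coord_field i k p) (coord_field i l p) : R^o).
Proof.
move=> a_smooth ip.
pose phi q : R^o := a q (coord_field i k q) (coord_field i l q).
have phi_cont : {for coord i p, continuous (phi \o param i)}.
  by have := a_smooth i k l 0%N; apply; exists p.
change (phi q @[q --> p] --> phi p); rewrite -{2}(coordK ip).
apply: cvg_trans (continuous_comp (coord_continuous ip) phi_cont).
apply: near_eq_cvg.
apply: filterS (open_nbhs_nbhs (conj (dom_open i) ip)) => q iq /=.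
by rewrite coordK.
Qed.

Lemma det_gram_coord_field_neq0 (met : riemannian_metric M) (i : chart M)
    (p : M) :
  dom i p -> \det (gram_mx (met p) (fun k => coord_field i k p)) != 0.
Proof.
move=> ip; apply/negP => /det0P[u u_neq0 uG0].
pose X := \sum_k u 0 k *: coord_field i k p.
have X_neq0 : X != 0.
  apply: contraNneq u_neq0 => X0; pose ip' : chart_at p := exist _ i ip.
  have -> : u = components X ip'.
    rewrite /X (big_morph (fun v : tangent p => components v ip')
      (op1 := +%R) (id1 := 0))//.
    rewrite [LHS]row_sum_delta; apply: eq_bigr => k _.
    rewrite /coord_field; case: pselect => // ip''.
    rewrite (_ : components (u 0 k *: _) ip' = u 0 k *:
      components (tangent_of (exist _ i ip'') (delta_mx 0 k)) ip')//.
    by rewrite (Prop_irrelevance ip'' ip) tangent_ofK.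
  by rewrite X0.
have := metric_pos met X_neq0.
rewrite {2}/X linear_sumr big1 ?ltxx// => k _; rewrite linearZr_LR.
rewrite /X linear_sumlz.
have /rowP/(_ k) := uG0; rewrite !mxE => uGk.
rewrite (eq_bigr (fun j =>
  u 0 j * gram_mx (met p) (fun k => coord_field i k p) j k)).
  by rewrite uGk /= mulr0.
by move=> j _; rewrite linearZl_LR !mxE.
Qed.

Lemma dual_tensor_spectrum (met : riemannian_metric M) (a : tensor02 M)
    (A : tensor11 M) (p : M) :
  symmetric_tensor02 a -> is_dual_tensor met a A ->
  exists d : 'I_n -> R, [/\
    forall l, \dim (leigenspace (A p) l) = #|[pred i | d i == l]|,
    forall k, lfun_trace (lfun_exp (A p) k) = \sum_i d i ^+ k &
    forall (X : 'I_n -> tangent p) x,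
      \det (gram_mx (fun u v => met p (A p u) v - x * met p u v) X) =
        (\prod_i (d i - x)) * \det (gram_mx (met p) X)].
Proof.
move=> a_sym A_dual; apply: selfadjoint_spectrum.
- exact: dim_tangent.
- exact: metric_symmetric.
- by move=> X; exact: metric_pos.
- by move=> X Y; rewrite A_dual a_sym -A_dual metric_symmetric.
Qed.

(** The eigenvalues persist near [p] because, at an eigenvalue [x] of [A p], the
    characteristic polynomial of [A q] tends to 0 as [q] tends to [p]. In
    coordinate fields it is, up to sign, the quotient of the determinants of
    [a - x met] and of [met], both continuous. *)
Lemma leigenspace_dual_locally_constant (met : riemannian_metric M)
    (a : tensor02 M) (A : tensor11 M) g :
  smooth_tensor02 a -> symmetric_tensor02 a -> is_dual_tensor met a A ->
  (forall p : M, ([set l : R | leigenvalue (A p) l] #= `I_g)%card) ->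
  (forall k : nat, (1 <= k <= g)%N ->
     exists c : R, forall p : M, lfun_trace (lfun_exp (A p) k) = c) ->
  forall p, \forall q \near p, forall l,
    \dim (leigenspace (A q) l) = \dim (leigenspace (A p) l).
Proof.
move=> a_smooth a_sym A_dual A_g A_tr p.
have /choice[d dP] q := dual_tensor_spectrum q a_sym A_dual.
have d_g q : size (undup (codom (d q))) = g.
  apply: card_values_codom; have [dim_q _ _] := dP q.
  suff -> : [set l | exists i, d q i = l] = [set l | leigenvalue (A q) l] by [].
  apply/seteqP; split=> l /=; rewrite /leigenvalue -dimv_eq0 dim_q -lt0n.
    by move=> [i <-]; apply/card_gt0P; exists i; rewrite inE.
  by case/card_gt0P => i; rewrite inE => /eqP <-; exists i.
have d_sum q k : (1 <= k <= g)%N -> \sum_i d q i ^+ k = \sum_i d p i ^+ k.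
  move=> /A_tr[c trc]; have [_ tr_q _] := dP q; have [_ tr_p _] := dP p.
  by rewrite -tr_q -tr_p !trc.
have d_prod i : \prod_j (d q j - d p i) @[q --> p] --> 0.
  have [c cp] := dom_cover p.
  pose X q k := coord_field c k q.
  pose num q : R :=
    \det (gram_mx (fun u v => met q (A q u) v - d p i * met q u v) (X q)).
  pose den q : R := \det (gram_mx (met q) (X q)).
  have prodE q : dom c q -> \prod_j (d q j - d p i) = num q / den q.
    move=> cq; have [_ _ det_q] := dP q.
    by rewrite /num det_q mulfK// det_gram_coord_field_neq0.
  have -> : 0 = num p / den p.
    by rewrite -prodE// (bigD1 i)//= subrr mul0r.
  have : num q / den q @[q --> p] --> num p / den p.
    apply: cvgM; last apply: cvgV; last first.
    - apply: cvg_det => k l; rewrite mxE; under eq_cvg do rewrite mxE.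
      exact: smooth_tensor02_cvg (metric_smooth met) cp.
    - exact: det_gram_coord_field_neq0.
    apply: cvg_det => k l; rewrite mxE; under eq_cvg do rewrite mxE A_dual.
    rewrite A_dual; apply: cvgB; first exact: smooth_tensor02_cvg.
    apply: cvgM; first exact: cvg_cst.
    exact: smooth_tensor02_cvg (metric_smooth met) cp.
  apply: cvg_trans; apply: near_eq_cvg.
  apply: filterS (open_nbhs_nbhs (conj (dom_open c) cp)) => q cq.
  by rewrite prodE.
apply: filterS (eq_multiplicities_near (d_g p) d_g d_sum d_prod) => q dq l.
have [-> _ _] := dP q; have [-> _ _] := dP p; exact: dq.
Qed.
End CoordinateFields.

Theorem proposition1p1 (R : realType) (n : nat) (M : smooth_manifold R n)
    (M_compact : compact [set: M]) (M_connected : connected [set: M])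
    (met : riemannian_metric M)
    (a : tensor02 M) (a_smooth : smooth_tensor02 a)
    (a_sym : symmetric_tensor02 a)
    (A : tensor11 M) (A_dual : is_dual_tensor met a A)
    (g : nat) (g_lt_n : (g < n)%N)
    (g_eigenvalues : forall p : M,
       ([set l : R | leigenvalue (A p) l] #= `I_g)%card)
    (trace_const : forall k : nat, (1 <= k <= g)%N ->
       exists c : R, forall p : M, lfun_trace (lfun_exp (A p) k) = c) :
  exists lambda : 'I_n -> R, forall (p : M) (l : R),
    \dim (leigenspace (A p) l) = #|[pred i | lambda i == l]|.
Proof.
have [[p0 _]|M_empty] := pselect (exists p : M, True); last first.
  by exists (fun=> 0) => p; case: M_empty; exists p.
have [lambda [dim_p0 _ _]] := dual_tensor_spectrum p0 a_sym A_dual.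
exists lambda => p l; rewrite -dim_p0.
have mult_loc (q : M) : \forall r \near q,
    (fun x => \dim (leigenspace (A r) x)) =
    (fun x => \dim (leigenspace (A q) x)).
  apply: filterS (leigenspace_dual_locally_constant a_smooth a_sym A_dual
    g_eigenvalues trace_const q) => r rq.
  exact/funext.
exact: (congr1 (@^~ l) (locally_constant_connected M_connected mult_loc p p0)).
Qed.
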